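(* Let $H_1$ and $H_2$ be shortest path graphs. Then the Cartesian product $H_1\,\square\,H_2$ is also a shortest path graph.
   Context: Graphs are finite and simple. For a graph $G$ with distinct vertices $a,b$, a shortest $a,b$-path is a path between $a$ and $b$ of length $d_G(a,b)$. The shortest path graph $S(G,a,b)$ is the graph whose vertices are the shortest $a,b$-paths in $G$, two of them being adjacent if and only if the corresponding paths differ in exactly one vertex. A graph $H$ is called a shortest path graph if there exist a graph $G$ and distinct $a,b\in V(G)$ with $S(G,a,b)\cong H$. The Cartesian product $H_1\,\square\,H_2$ has vertex set $V(H_1)\times V(H_2)$, with $(x_1,x_2)$ adjacent to $(y_1,y_2)$ if and only if either $x_1=y_1$ and $x_2\sim y_2$ in $H_2$, or $x_1\sim y_1$ in $H_1$ and $x_2=y_2$. *)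

(* Defs.v *)
From mathcomp Require Import all_boot.

Set Implicit Arguments.
Unset Strict Implicit.
Unset Printing Implicit Defensive.

Record sgraph := SGraph {
  vertex :> finType;
  edge : rel vertex;
  edge_sym : symmetric edge;
  edge_irr : irreflexive edge
}.

(* The vertices of the path are, in order, those of the sequence a :: p, so   *)
(* that its length (number of edges) is size p.                               *)
Definition is_path (G : sgraph) (a b : G) (p : seq G) : bool :=
  [&& path (@edge G) a p, last a p == b & uniq (a :: p)].

(* The least length of an a,b-path. Every path has length < #|G|; the value   *)
(* of dist a b is #|G|, standing for infinity, iff there is no a,b-path.      *)
Definition dist (G : sgraph) (a b : G) : nat :=
  find (fun n => [exists p : n.-tuple G, is_path a b p]) (iota 0 #|G|).

Definition shortest_path (G : sgraph) (a b : G) : finType :=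
  {p : (dist a b).-tuple G | is_path a b p}.

(* Positions at which the paths differ; the common first vertex a is left out *)
(* of the tuples.                                                             *)
Definition diff_pos (G : sgraph) (a b : G) (p q : shortest_path a b) :
    {set 'I_(dist a b)} :=
  [set i | tnth (val p) i != tnth (val q) i].

Definition sp_edge (G : sgraph) (a b : G) : rel (shortest_path a b) :=
  fun p q => #|diff_pos p q| == 1.

Lemma sp_edge_sym (G : sgraph) (a b : G) : symmetric (@sp_edge G a b).
Proof.
move=> p q; rewrite /sp_edge; congr (#|pred_of_set _| == 1).
by apply/setP => i; rewrite !inE eq_sym.
Qed.

Lemma sp_edge_irr (G : sgraph) (a b : G) : irreflexive (@sp_edge G a b).
Proof.
move=> p; rewrite /sp_edge (_ : diff_pos p p = set0) ?cards0 //.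
by apply/setP => i; rewrite !inE eqxx.
Qed.

Definition shortest_path_graph (G : sgraph) (a b : G) : sgraph :=
  SGraph (@sp_edge_sym G a b) (@sp_edge_irr G a b).

Definition isomorphic (G H : sgraph) : Prop :=
  exists2 f : G -> H, bijective f & forall x y, edge (f x) (f y) = edge x y.

Definition is_shortest_path_graph (H : sgraph) : Prop :=
  exists (G : sgraph) (a b : G), a != b /\ isomorphic (shortest_path_graph a b) H.

Definition cart_edge (H1 H2 : sgraph) : rel (H1 * H2) :=
  fun x y => (x.1 == y.1) && edge x.2 y.2 || edge x.1 y.1 && (x.2 == y.2).

Lemma cart_edge_sym (H1 H2 : sgraph) : symmetric (@cart_edge H1 H2).
Proof.
move=> x y; rewrite /cart_edge (eq_sym x.1) (eq_sym x.2).
by rewrite (edge_sym x.1) (edge_sym x.2).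
Qed.

Lemma cart_edge_irr (H1 H2 : sgraph) : irreflexive (@cart_edge H1 H2).
Proof. by move=> x; rewrite /cart_edge !edge_irr andbF. Qed.

Definition cartesian_product (H1 H2 : sgraph) : sgraph :=
  SGraph (@cart_edge_sym H1 H2) (@cart_edge_irr H1 H2).

(* Main.v *)
(** Realise H1 and H2 in graphs G1 and G2, and join b1 to a2 by a new edge in
    the disjoint union of G1 and G2. This edge is a bridge, so a path from a1
    to b2 crosses it exactly once: it is an a1,b1-path of G1 followed by an
    a2,b2-path of G2, and it is shortest iff both pieces are. Two such paths
    differ in as many vertices as their two pieces together, which is the
    adjacency of the Cartesian product. *)
Require Import Defs.
From mathcomp Require Import all_boot.

Set Implicit Arguments.
Unset Strict Implicit.
Unset Printing Implicit Defensive.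

(** * Isomorphisms of graphs *)

Lemma isomorphic_sym (G H : sgraph) : isomorphic G H -> isomorphic H G.
Proof.
case=> f [g fK gK] fE; exists g; first by exists f.
by move=> x y; rewrite -fE !gK.
Qed.

Lemma isomorphic_trans (G H K : sgraph) :
  isomorphic G H -> isomorphic H K -> isomorphic G K.
Proof.
case=> f f_bij fE [g g_bij gE]; exists (g \o f); first exact: bij_comp.
by move=> x y /=; rewrite gE fE.
Qed.

Lemma isomorphic_cartesian (G1 G2 H1 H2 : sgraph) :
  isomorphic G1 H1 -> isomorphic G2 H2 ->
  isomorphic (cartesian_product G1 G2) (cartesian_product H1 H2).
Proof.
case=> f [f' fK f'K] fE [g [g' gK g'K] gE].
exists (fun x : G1 * G2 => (f x.1, g x.2) : H1 * H2).
  exists (fun y : H1 * H2 => (f' y.1, g' y.2)).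
    by case=> x y /=; rewrite fK gK.
  by case=> x y /=; rewrite f'K g'K.
move=> x y; rewrite /= /cart_edge /= fE gE.
by rewrite (inj_eq (can_inj fK)) (inj_eq (can_inj gK)).
Qed.

(** For the degenerate case in which one factor has no vertices because its two end vertices are not
    connected. *)
Lemma isomorphic_empty (G H : sgraph) :
  (G -> False) -> (H -> False) -> isomorphic G H.
Proof.
move=> G0 H0; exists (fun x => False_rect _ (G0 x)); last by move=> x; case: (G0 x).
by exists (fun y => False_rect _ (H0 y)) => [x|y]; [case: (G0 x) | case: (H0 y)].
Qed.

(** * Path lengths and distance *)

Lemma is_path_size (G : sgraph) (a b : G) (p : seq G) :
  is_path a b p -> size p < #|G|.
Proof. case/and3P=> _ _ /card_uniqP p_card.
by rewrite (leq_trans _ (max_card (mem (a :: p)))) // p_card. Qed.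

Lemma dist_le (G : sgraph) (a b : G) (p : seq G) :
  is_path a b p -> dist a b <= size p.
Proof.
move=> p_path; have p_lt := is_path_size p_path.
rewrite leqNgt; apply/negP => /(before_find 0).
rewrite nth_iota // add0n => /negbT/existsP[].
by exists (in_tuple p).
Qed.

(** The given path has length below [#|G|], so the search in [dist] succeeds and does not return its
    value for infinity. *)
Lemma dist_attained (G : sgraph) (a b : G) (p : seq G) :
  is_path a b p -> exists2 q, is_path a b q & size q = dist a b.
Proof.
move=> p_path; have p_lt := is_path_size p_path.
set P := fun n => [exists p : n.-tuple G, is_path a b p].
have P_has : has P (iota 0 #|G|).
  apply/hasP; exists (size p); first by rewrite mem_iota.
  by apply/existsP; exists (in_tuple p).
have := nth_find 0 P_has.
rewrite nth_iota -1?[X in _ < X](size_iota 0) -?has_find //.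
by rewrite add0n => /existsP[q q_path]; exists q; rewrite ?size_tuple.
Qed.

(** * Hamming distance of sequences *)

Definition hamming {T : eqType} (s t : seq T) : nat :=
  count (fun xy => xy.1 != xy.2) (zip s t).

Lemma hamming_cat (T : eqType) (s1 s2 t1 t2 : seq T) : size s1 = size t1 ->
  hamming (s1 ++ s2) (t1 ++ t2) = hamming s1 t1 + hamming s2 t2.
Proof. by move=> eq_sz; rewrite /hamming zip_cat // count_cat. Qed.

Lemma hamming_map (T U : eqType) (f : T -> U) (s t : seq T) :
  injective f -> hamming (map f s) (map f t) = hamming s t.
Proof.
move=> f_inj; rewrite /hamming.
by elim: s t => [|x s IHs] [|y t] //=; rewrite IHs (inj_eq f_inj).
Qed.

(** Since [zip] truncates to the shorter sequence, equal lengths are what makes a zero count imply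
    equality. *)
Lemma hamming_eq0 (T : eqType) (s t : seq T) :
  size s = size t -> (hamming s t == 0) = (s == t).
Proof.
rewrite /hamming; elim: s t => [|x s IHs] [|y t] //= [eq_sz].
by rewrite addn_eq0 IHs // eqseq_cons eqb0 negbK.
Qed.

(** Passing to plain sequences removes the distance from the types, so paths can be concatenated
    without casts. *)
Lemma card_diff_pos (G : sgraph) (a b : G) (p q : shortest_path a b) :
  #|diff_pos p q| = hamming (val (val p)) (val (val q)).
Proof.
rewrite /hamming -sum1_count -sum1dep_card.
rewrite -[zip _ _]/(val (zip_tuple (val p) (val q))) big_tuple.
apply: eq_bigl => i; rewrite (tnth_nth (a, a)) /= nth_zip ?size_tuple //=.
by rewrite -!tnth_nth.
Qed.

(** * Two graphs joined by a bridge *)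

Section Bridge.

Variables (G1 G2 : sgraph) (b1 : G1) (a2 : G2).

Definition bridge_edge : rel (G1 + G2) := fun x y =>
  match x, y with
  | inl u, inl v => edge u v
  | inr u, inr v => edge u v
  | inl u, inr v => (u == b1) && (v == a2)
  | inr u, inl v => (v == b1) && (u == a2)
  end.

Lemma bridge_edge_sym : symmetric bridge_edge.
Proof. by case=> u [] v //=; apply: edge_sym. Qed.

Lemma bridge_edge_irr : irreflexive bridge_edge.
Proof. by case=> u /=; apply: edge_irr. Qed.

Definition bridge : sgraph := SGraph bridge_edge_sym bridge_edge_irr.

(** Path sequences omit their first vertex, so the start [a2] of the second piece has to be put back
    at the seam. *)
Definition bridge_seq (p1 : seq G1) (p2 : seq G2) : seq bridge :=
  map inl p1 ++ inr a2 :: map inr p2.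

Lemma size_bridge_seq (p1 : seq G1) (p2 : seq G2) :
  size (bridge_seq p1 p2) = size p1 + (size p2).+1.
Proof. by rewrite size_cat /= !size_map. Qed.

Lemma path_map_inl (x : G1) (p : seq G1) :
  path (@edge bridge) (inl x) (map inl p) = path (@edge G1) x p.
Proof. exact: path_map. Qed.

Lemma path_map_inr (x : G2) (p : seq G2) :
  path (@edge bridge) (inr x) (map inr p) = path (@edge G2) x p.
Proof. exact: path_map. Qed.

Lemma is_path_bridge_seq (a1 : G1) (b2 : G2) (p1 : seq G1) (p2 : seq G2) :
  is_path (inl a1 : bridge) (inr b2) (bridge_seq p1 p2)
    = is_path a1 b1 p1 && is_path a2 b2 p2.
Proof.
have inl_inj : injective (@inl G1 G2) by move=> ? ? [].
have inr_inj : injective (@inr G1 G2) by move=> ? ? [].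
have uniqE : uniq ((inl a1 : bridge) :: bridge_seq p1 p2)
    = uniq (a1 :: p1) && uniq (a2 :: p2).
  (* With both first vertices present, this is a concatenation of images in the two disjoint
     summands. *)
  rewrite -[_ :: _]/(map inl (a1 :: p1) ++ map inr (a2 :: p2)).
  rewrite cat_uniq !map_inj_uniq //.
  suff -> : has (mem (map inl (a1 :: p1))) (map inr (a2 :: p2)) = false by [].
  by apply/hasP => -[_ /mapP[y _ ->] /mapP[]].
rewrite /is_path uniqE cat_path last_cat path_map_inl last_map.
rewrite [path _ _ (_ :: _)]/= [last _ (_ :: _)]/= path_map_inr last_map.
rewrite (inj_eq inr_inj) /= eqxx andbT.
by case: (path _ a1 _); case: (path _ a2 _); case: (_ == b1); case: (_ == b2);
  rewrite ?andbF.
Qed.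

(** The only way back from [G2] into [G1] leads through [b1]. *)
Lemma path_inr_avoid (y : G2) (s : seq bridge) :
    path (@edge bridge) (inr y) s -> inl b1 \notin s ->
  exists p, s = map inr p.
Proof.
elim: s y => [|[u|v] s IHs] y /=; first by exists [::].
  by case/andP=> /andP[/eqP-> _] _; rewrite inE eqxx.
case/andP=> _ /IHs{}IHs; rewrite inE => /= /IHs[p ->].
by exists (v :: p).
Qed.

(** Follow the walk until it first leaves [G1]: that step goes from [b1] to [a2], and as no vertex
    repeats, [b1] cannot be used to return. *)
Lemma path_inl_cross (x : G1) (b2 : G2) (s : seq bridge) :
    path (@edge bridge) (inl x) s -> uniq (inl x :: s) ->
    last (inl x) s = inr b2 ->
  exists p1 p2, s = bridge_seq p1 p2.
Proof.
elim: s x => [|[u|v] s IHs] x //.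
  case/andP=> _ s_path /andP[_ s_uniq] s_last.
  have [p1 [p2 ->]] := IHs u s_path s_uniq s_last.
  by exists (u :: p1), p2.
case/andP=> /andP[/eqP-> /eqP->] s_path /andP[].
rewrite inE => /= b1_notin _ _.
by have [p2 ->] := path_inr_avoid s_path b1_notin; exists [::], p2.
Qed.

Lemma is_path_bridge (a1 : G1) (b2 : G2) (s : seq bridge) :
    is_path (inl a1 : bridge) (inr b2) s ->
  exists p1 p2, [/\ s = bridge_seq p1 p2, is_path a1 b1 p1 & is_path a2 b2 p2].
Proof.
move=> s_path; have /and3P[s_walk /eqP s_last s_uniq] := s_path.
have [p1 [p2 def_s]] := path_inl_cross s_walk s_uniq s_last.
exists p1, p2; move: s_path.
by rewrite def_s is_path_bridge_seq => /andP[].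
Qed.

(** Joining shortest pieces gives the upper bound; cutting a shortest path at the bridge gives the
    lower one. The successor counts the bridge edge. *)
Lemma dist_bridge (a1 : G1) (b2 : G2) (p1 : seq G1) (p2 : seq G2) :
    is_path a1 b1 p1 -> is_path a2 b2 p2 ->
  dist (inl a1 : bridge) (inr b2) = dist a1 b1 + (dist a2 b2).+1.
Proof.
move=> p1_path p2_path; apply/eqP; rewrite eqn_leq; apply/andP; split.
  have [q1 q1_path <-] := dist_attained p1_path.
  have [q2 q2_path <-] := dist_attained p2_path.
  by rewrite -size_bridge_seq dist_le // is_path_bridge_seq q1_path.
have p_path : is_path (inl a1 : bridge) (inr b2) (bridge_seq p1 p2).
  by rewrite is_path_bridge_seq p1_path.
have [s s_path <-] := dist_attained p_path.
have [r1 [r2 [-> r1_path r2_path]]] := is_path_bridge s_path.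
by rewrite size_bridge_seq leq_add ?ltnS ?dist_le.
Qed.

Lemma hamming_bridge_seq (p1 q1 : seq G1) (p2 q2 : seq G2) :
    size p1 = size q1 ->
  hamming (bridge_seq p1 p2) (bridge_seq q1 q2) = hamming p1 q1 + hamming p2 q2.
Proof.
move=> eq_sz; rewrite hamming_cat ?size_map // hamming_map; last by move=> ? ? [].
(* Both sequences have [a2] at the seam, which adds nothing to the count. *)
rewrite -!map_cons -(hamming_map (f := inr) (T := G2) (U := bridge) p2).
  by rewrite /hamming /= eqxx.
by move=> ? ? [].
Qed.

Lemma isomorphic_bridge (a1 : G1) (b2 : G2) (p1 : seq G1) (p2 : seq G2) :
    is_path a1 b1 p1 -> is_path a2 b2 p2 ->
  isomorphic
    (cartesian_product (shortest_path_graph a1 b1) (shortest_path_graph a2 b2))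
    (shortest_path_graph (inl a1 : bridge) (inr b2)).
Proof.
move=> p1_path p2_path; have dE := dist_bridge p1_path p2_path.
pose S1 := shortest_path a1 b1; pose S2 := shortest_path a2 b2.
pose S := shortest_path (inl a1 : bridge) (inr b2).
(* Joining pieces is the isomorphism sought; [f] is extracted from this existence statement. *)
have join_ex (x : S1 * S2) :
    exists s : S, val (val s) = bridge_seq (val (val x.1)) (val (val x.2)).
  case: x => x1 x2 /=; set s := bridge_seq _ _.
  have s_size : size s == dist (inl a1 : bridge) (inr b2).
    by rewrite dE size_bridge_seq !size_tuple.
  have s_path : is_path (inl a1 : bridge) (inr b2) (Tuple s_size).
    by rewrite is_path_bridge_seq (valP x1) (valP x2).
  by exists (Sub (Tuple s_size) s_path).
have [f fE] := fin_all_exists join_ex.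
have f_diff x y : #|diff_pos (f x) (f y)|
    = #|diff_pos x.1 y.1| + #|diff_pos x.2 y.2|.
  by rewrite !card_diff_pos !fE hamming_bridge_seq ?size_tuple.
(* Equality becomes a zero count, so injectivity and adjacency both follow from the additivity in
   [f_diff]. *)
have diff0 (G : sgraph) (a b : G) (p q : shortest_path a b) :
    (#|diff_pos p q| == 0) = (p == q).
  by rewrite card_diff_pos hamming_eq0 ?size_tuple.
have f_inj : injective f.
  case=> x1 x2 [y1 y2] /eqP; rewrite -diff0 f_diff addn_eq0 !diff0 /=.
  by case/andP=> /eqP-> /eqP->.
have f_surj (s : S) : exists x, f x = s.
  (* Each piece is at least as long as its distance and the total length equals the sum, so both
     pieces are shortest. *)
  have [q1 [q2 [def_s q1_path q2_path]]] := is_path_bridge (valP s).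
  have /eqP := congr1 size def_s; rewrite size_tuple dE size_bridge_seq eq_sym.
  have := dist_le q1_path; have := dist_le q2_path.
  rewrite -ltnS => le2 le1 /eqP eq_sz.
  have /eqP sz1 : size q1 = dist a1 b1.
    by apply/eqP; rewrite eqn_leq le1 -(leq_add2r (size q2).+1) eq_sz leq_add2l le2.
  have /eqP sz2 : size q2 = dist a2 b2.
    by move: eq_sz; rewrite (eqP sz1) => /addnI[].
  exists (Sub (Tuple sz1) q1_path, Sub (Tuple sz2) q2_path).
  by apply/val_inj/val_inj; rewrite fE; apply: esym.
have [g gK] := fin_all_exists f_surj.
exists f; first by exists g => // x; apply: f_inj; rewrite gK.
move=> x y; rewrite /= /sp_edge f_diff /cart_edge /= /sp_edge -!diff0.
(* A sum of two naturals is 1 iff one is 0 and the other is 1. *)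
by case: #|diff_pos x.1 y.1| #|diff_pos x.2 y.2| => [|[|m]] [|[|n]].
Qed.

End Bridge.

Theorem corollary11 (H1 H2 : sgraph)
    (hH1 : is_shortest_path_graph H1) (hH2 : is_shortest_path_graph H2) :
  is_shortest_path_graph (cartesian_product H1 H2).
Proof.
have [G1 [a1 [b1 [a1b1 iso1]]]] := hH1; have [G2 [a2 [b2 [a2b2 iso2]]]] := hH2.
(* If [a1] and [b1] are not connected, [H1] and hence the product are empty, and [G1] already
   realises the product; likewise for the second factor. *)
have [p1 _ | no_p1] := pickP (@predT (shortest_path a1 b1)); last first.
  have [_ [h1 _ _] _] := iso1.
  exists G1, a1, b1; split=> //; apply: isomorphic_empty => [p|[x _]].
    by have := no_p1 p.
  by have := no_p1 (h1 x).
have [p2 _ | no_p2] := pickP (@predT (shortest_path a2 b2)); last first.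
  have [_ [h2 _ _] _] := iso2.
  exists G2, a2, b2; split=> //; apply: isomorphic_empty => [p|[_ x]].
    by have := no_p2 p.
  by have := no_p2 (h2 x).
exists (bridge b1 a2), (inl a1), (inr b2); split=> //.
apply: isomorphic_trans (isomorphic_cartesian iso1 iso2).
exact/isomorphic_sym/(isomorphic_bridge (valP p1) (valP p2)).
Qed.
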